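(* Consider the constant-free, equality-free, monadic fragment of $\mathrm{FO}^2$ extended with four binary special symbols $E_1, E_2, F_1, F_2$, each interpreted as an equivalence relation, subject to $E_1 \subseteq E_2$ and $F_1 \subseteq F_2$ (with no constraint relating the $E$'s to the $F$'s). Both the satisfiability problem and the finite satisfiability problem for this logic are undecidable.
   Context: $\mathrm{FO}^2$ is the fragment of first-order logic whose formulas use only the two variables $x$ and $y$ (which may be re-quantified). ''Constant-free, equality-free, monadic fragment'' means that, apart from the four special binary symbols $E_1,E_2,F_1,F_2$, formulas use only unary relation symbols, and use neither constant symbols nor the equality symbol. *)

(* Defs.v *)
From mathcomp Require Import all_boot.
Set Implicit Arguments. Unset Strict Implicit. Unset Printing Implicit Defensive.

Inductive var := vx | vy.
Inductive sym := E1 | E2 | F1 | F2.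

Inductive form :=
| Pred (n : nat) (v : var)
| Bin (s : sym) (v w : var)
| Neg (f : form)
| And (f g : form)
| Or (f g : form)
| Ex (v : var) (f : form)
| All (v : var) (f : form).

Record structure (D : Type) := Structure {
  pred_of : nat -> D -> Prop;
  rel_of : sym -> D -> D -> Prop }.

Definition is_equiv (D : Type) (R : D -> D -> Prop) :=
  (forall a, R a a) /\ (forall a b, R a b -> R b a) /\
  (forall a b c, R a b -> R b c -> R a c).

Definition admissible (D : Type) (M : structure D) :=
  (forall s, is_equiv (rel_of M s)) /\
  (forall a b, rel_of M E1 a b -> rel_of M E2 a b) /\
  (forall a b, rel_of M F1 a b -> rel_of M F2 a b).

Definition upd (D : Type) (asg : var -> D) (v : var) (d : D) : var -> D :=
  fun w => match v, w with
           | vx, vx | vy, vy => d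
           | _, _ => asg w
           end.

Fixpoint holds (D : Type) (M : structure D) (asg : var -> D) (f : form) : Prop :=
  match f with
  | Pred n v => pred_of M n (asg v)
  | Bin s v w => rel_of M s (asg v) (asg w)
  | Neg g => ~ holds M asg g
  | And g h => holds M asg g /\ holds M asg h
  | Or g h => holds M asg g \/ holds M asg h
  | Ex v g => exists d : D, holds M (upd asg v d) g
  | All v g => forall d : D, holds M (upd asg v d) g
  end.

(* Satisfiable: some (nonempty, witnessed by the assignment) structure. *)
Definition satisfiable (f : form) : Prop :=
  exists (D : Type) (M : structure D) (asg : var -> D),
    admissible M /\ holds M asg f.

Definition fin_satisfiable (f : form) : Prop :=
  exists (D : finType) (M : structure D) (asg : var -> D),
    admissible M /\ holds M asg f.

Definition cpair (a b : nat) : nat := (a + b) * (a + b).+1 %/ 2 + b.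

Definition code_var (v : var) : nat := match v with vx => 0 | vy => 1 end.
Definition code_sym (s : sym) : nat :=
  match s with E1 => 0 | E2 => 1 | F1 => 2 | F2 => 3 end.

Fixpoint code (f : form) : nat :=
  match f with
  | Pred n v => cpair 0 (cpair n (code_var v))
  | Bin s v w => cpair 1 (cpair (code_sym s) (cpair (code_var v) (code_var w)))
  | Neg g => cpair 2 (code g)
  | And g h => cpair 3 (cpair (code g) (code h))
  | Or g h => cpair 4 (cpair (code g) (code h))
  | Ex v g => cpair 5 (cpair (code_var v) (code g))
  | All v g => cpair 6 (cpair (code_var v) (code g))
  end.

Inductive instr :=
| INC (r : nat)
| DEC (r : nat) (j : nat).

Definition config := (nat * (nat -> nat))%type.

Definition halted (P : seq instr) (c : config) : bool := size P <= c.1.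

Definition setreg (R : nat -> nat) (r v : nat) : nat -> nat :=
  fun r' => if r' == r then v else R r'.

Definition step (P : seq instr) (c : config) : config :=
  let: (pc, R) := c in
  if pc < size P then
    match nth (INC 0) P pc with
    | INC r => (pc.+1, setreg R r (R r).+1)
    | DEC r j => if R r == 0 then (j, R) else (pc.+1, setreg R r (R r).-1)
    end
  else c.

Definition init (input : nat) : config :=
  (0, fun r => if r == 0 then input else 0).

Definition computes (P : seq instr) (n out : nat) : Prop :=
  exists k, halted P (iter k (step P) (init n)) /\
            (iter k (step P) (init n)).2 0 = out.

Definition decidable_form (Q : form -> Prop) : Prop :=
  exists P : seq instr, forall f : form,
    (Q f -> computes P (code f) 1) /\ (~ Q f -> computes P (code f) 0).

(* Main.v *)
(* A model is read as a sequence of rows, one for each time step of a counter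
   machine: E2 joins rows 2m and 2m+1 and F2 joins rows 2m+1 and 2m+2, so every
   row is the set of elements of one parity in an E2-class, while E1 and F1 match
   the elements of consecutive rows one to one.  The value of register r at time
   i is the number of elements of colour r in row i; with two variables one can
   say that the matching preserves a colour, up to one element that is added or
   removed, and that a row lacks a colour, which covers every instruction.  A
   machine then runs forever iff its formula, with leaving the program
   forbidden, is satisfiable; it halts iff the formula without that clause is
   finitely satisfiable (a start row without predecessor keeps the rows of a
   model distinct).
   For undecidability, let a machine M map an input n to the code of
   "n /\ Init n", where Init n says that the input is n, run the supposed decision
   procedure P on it, and halt or loop so as to refute the answer.  The input
   n := code of the formula of M makes M ask about its own behaviour. *)

Require Import Defs.
From mathcomp Require Import all_boot.
From mathcomp Require Import zify.
From Stdlib Require Import Classical FunctionalExtensionality.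

Set Implicit Arguments. Unset Strict Implicit. Unset Printing Implicit Defensive.

(** * Counter machines *)

Definition run (P : seq instr) (c c' : config) : Prop :=
  exists k, iter k (step P) c = c'.

Lemma run_refl P c : run P c c.
Proof. by exists 0. Qed.

Lemma run_trans P c1 c2 c3 : run P c1 c2 -> run P c2 c3 -> run P c1 c3.
Proof. by move=> [k <-] [l <-]; exists (l + k); rewrite iterD. Qed.

Lemma run_step P c c' : run P (step P c) c' -> run P c c'.
Proof. by move=> [k <-]; exists k.+1; rewrite iterSr. Qed.

Lemma halted_step P c : halted P c -> step P c = c.
Proof. by case: c => pc R; rewrite /halted /step ltnNge /= => ->. Qed.

Lemma halted_iter P c k : halted P c -> iter k (step P) c = c.
Proof. by move=> h; elim: k => //= k ->; rewrite halted_step. Qed.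

(** A halted configuration never changes again, so a halt at time [k] would make the configuration
    halted there equal to the fixed point [c'], which is not halted. *)
Lemma stuck_never_halts P c c' k :
  run P c c' -> step P c' = c' -> ~~ halted P c' -> ~~ halted P (iter k (step P) c).
Proof.
move=> [l Hl] fix_c' /negP nh; apply/negP => hk; apply: nh.
have iter_c' j : iter j (step P) c' = c' by elim: j => //= j ->.
by rewrite -(iter_c' k) -Hl -iterD addnC iterD halted_iter.
Qed.

Inductive cmd :=
| CInc (r : nat)
| CSeq (c1 c2 : cmd)
| CLoop (r : nat) (c : cmd).

(* [CLoop r c]: while register [r] is nonzero, decrement it and run [c]. *)
Inductive exec : cmd -> (nat -> nat) -> (nat -> nat) -> Prop :=
| XInc r R : exec (CInc r) R (setreg R r (R r).+1)
| XSeq c1 c2 R1 R2 R3 : exec c1 R1 R2 -> exec c2 R2 R3 -> exec (CSeq c1 c2) R1 R3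
| XLoop0 r c R : R r = 0 -> exec (CLoop r c) R R
| XLoopS r c m R1 R2 R3 : R1 r = m.+1 -> exec c (setreg R1 r m) R2 ->
    exec (CLoop r c) R2 R3 -> exec (CLoop r c) R1 R3.

Fixpoint csize (c : cmd) : nat :=
  match c with
  | CInc _ => 1
  | CSeq c1 c2 => csize c1 + csize c2
  | CLoop _ c => (csize c).+2
  end.

(* Register [z] stays 0, so that [DEC z o] is an unconditional jump to [o]. *)
Fixpoint compile (z o : nat) (c : cmd) : seq instr :=
  match c with
  | CInc r => [:: INC r]
  | CSeq c1 c2 => compile z o c1 ++ compile z (o + csize c1) c2
  | CLoop r c => DEC r (o + (csize c).+2) :: rcons (compile z o.+1 c) (DEC z o)
  end.

Lemma size_compile z o c : size (compile z o c) = csize c.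
Proof.
elim: c o => //= [c1 IH1 c2 IH2|r c IH] o; first by rewrite size_cat IH1 IH2.
by rewrite size_rcons IH.
Qed.

Fixpoint avoids (z : nat) (c : cmd) : bool :=
  match c with
  | CInc r => r != z
  | CSeq c1 c2 => avoids z c1 && avoids z c2
  | CLoop r c => (r != z) && avoids z c
  end.

Lemma exec_avoids z c R R' : exec c R R' -> avoids z c -> R' z = R z.
Proof.
elim=> {c R R'} //=.
- by move=> r R; rewrite /setreg eq_sym => /negbTE ->.
- by move=> c1 c2 R1 R2 R3 _ IH1 _ IH2 /andP[/IH1 <- /IH2].
- move=> r c m R1 R2 R3 _ _ IH1 _ IH2 /andP[rz cz].
  by rewrite IH2 ?rz // IH1 // /setreg eq_sym (negbTE rz).
Qed.

Lemma step_INC P1 r P2 R :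
  step (P1 ++ INC r :: P2) (size P1, R) = ((size P1).+1, setreg R r (R r).+1).
Proof. by rewrite /step size_cat /= nth_cat ltnn subnn -addSnnS leq_addr. Qed.

Lemma step_DEC P1 r j P2 R :
  step (P1 ++ DEC r j :: P2) (size P1, R) =
  if R r == 0 then (j, R) else ((size P1).+1, setreg R r (R r).-1).
Proof. by rewrite /step size_cat /= nth_cat ltnn subnn -addSnnS leq_addr. Qed.

(** Induction on the execution. The surrounding code [P1], [P2] is quantified last because
    subcommands sit at other addresses: for a loop body [P1] grows by the test and [P2] by the jump
    back, which is taken because [z] still holds 0. *)
Lemma compile_correct z c R R' : exec c R R' -> R z = 0 -> avoids z c ->
  forall P1 P2, run (P1 ++ compile z (size P1) c ++ P2)
    (size P1, R) (size P1 + csize c, R').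
Proof.
elim=> {c R R'} /=.
- move=> r R _ _ P1 P2; exists 1.
  by rewrite iterS [iter 0 _ _]/= step_INC addn1.
- move=> c1 c2 R1 R2 R3 x1 IH1 _ IH2 z0 /andP[z1 z2] P1 P2.
  rewrite -catA; apply: run_trans (IH1 z0 z1 P1 _) _.
  have := IH2 _ z2 (P1 ++ compile z (size P1) c1) P2.
  rewrite size_cat size_compile -catA addnA; apply.
  by rewrite (exec_avoids x1).
- move=> r c R R0 _ _ P1 P2; exists 1.
  by rewrite iterS [iter 0 _ _]/= step_DEC R0.
- move=> r c m R1 R2 R3 R1r x1 IH1 _ IH2 z0 /andP[rz cz] P1 P2.
  have zr : (z == r) = false by rewrite eq_sym (negbTE rz).
  have s0 : setreg R1 r m z = 0 by rewrite /setreg zr.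
  have R2z : R2 z = 0 by rewrite (exec_avoids x1).
  apply: run_trans (IH2 R2z _ P1 P2); last by rewrite rz.
  set D := DEC r _; set P := P1 ++ _.
  have st0 : step P (size P1, R1) = ((size P1).+1, setreg R1 r m).
    by rewrite /P /D step_DEC R1r.
  apply: run_step; rewrite st0.
  have EP : P = rcons P1 D ++ compile z (size (rcons P1 D)) c ++ DEC z (size P1) :: P2.
    by rewrite /P size_rcons !cat_rcons.
  have := IH1 s0 cz (rcons P1 D) (DEC z (size P1) :: P2).
  rewrite -EP size_rcons => /run_trans; apply; apply: run_step.
  have -> : P = (P1 ++ D :: compile z (size P1).+1 c) ++ DEC z (size P1) :: P2.
    by rewrite /P -catA /= cat_rcons.
  have -> : (size P1).+1 + csize c = size (P1 ++ D :: compile z (size P1).+1 c).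
    by rewrite size_cat /= size_compile addSnnS.
  by rewrite step_DEC R2z eqxx; apply: run_refl.
Qed.

(** * Programs for the pairing function and for self-application *)

Definition store (s : seq nat) : nat -> nat := nth 0 s.

Lemma setreg_store s r v : setreg (store s) r v = store (set_nth 0 s r v).
Proof. by apply: functional_extensionality => i; rewrite /store nth_set_nth. Qed.

Lemma exec_inc s r : exec (CInc r) (store s) (store (set_nth 0 s r (nth 0 s r).+1)).
Proof. by rewrite -setreg_store; apply: XInc. Qed.

Lemma exec_seq c1 c2 s1 s2 s3 :
  exec c1 (store s1) (store s2) -> exec c2 (store s2) (store s3) ->
  exec (CSeq c1 c2) (store s1) (store s3).
Proof. exact: XSeq. Qed.

Lemma exec_loopS r c m s1 s2 s3 : nth 0 s1 r = m.+1 ->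
  exec c (store (set_nth 0 s1 r m)) (store s2) ->
  exec (CLoop r c) (store s2) (store s3) -> exec (CLoop r c) (store s1) (store s3).
Proof. by rewrite -setreg_store; apply: XLoopS. Qed.

Lemma exec_loop0 r c s : nth 0 s r = 0 -> exec (CLoop r c) (store s) (store s).
Proof. exact: XLoop0. Qed.

Definition triangle s := s * s.+1 %/ 2.

Lemma triangleS s : triangle s.+1 = triangle s + s.+1.
Proof.
by rewrite /triangle (_ : s.+1 * s.+2 = s * s.+1 + s.+1 * 2) ?divnMDl; nia.
Qed.

(** Arguments in registers 1 and 2, result in register 2. With [s] the sum in register 1, the middle
    loop adds [s + (s - 1) + ... + 1] to register 3; its inner loops move register 1 to register 4
    and back. *)
Definition pair_cmd : cmd :=
  CSeq (CLoop 2 (CSeq (CInc 1) (CInc 3)))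
  (CSeq (CLoop 1 (CSeq (CInc 3)
     (CSeq (CLoop 1 (CSeq (CInc 4) (CInc 3))) (CLoop 4 (CInc 1)))))
  (CLoop 3 (CInc 2))).

Lemma exec_pair a b x y w :
  exec pair_cmd (store [:: x; a; b; 0; 0; y; w])
                (store [:: x; 0; cpair a b; 0; 0; y; w]).
Proof.
have L1 : forall b a d, exec (CLoop 2 (CSeq (CInc 1) (CInc 3)))
    (store [:: x; a; b; d; 0; y; w]) (store [:: x; b + a; 0; b + d; 0; y; w]).
  elim=> [|b' IH] a' d; first exact: exec_loop0.
  apply: (@exec_loopS _ _ b') => //; last by rewrite !addSnnS; apply: IH.
  by apply: exec_seq; apply: exec_inc.
have L2 : forall a d e, exec (CLoop 1 (CSeq (CInc 4) (CInc 3)))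
    (store [:: x; a; 0; d; e; y; w]) (store [:: x; 0; 0; a + d; a + e; y; w]).
  elim=> [|b' IH] a' d; first exact: exec_loop0.
  apply: (@exec_loopS _ _ b') => //; last by rewrite !addSnnS; apply: IH.
  by apply: exec_seq; apply: exec_inc.
have L3 : forall e a d, exec (CLoop 4 (CInc 1))
    (store [:: x; a; 0; d; e; y; w]) (store [:: x; e + a; 0; d; 0; y; w]).
  elim=> [|b' IH] a' d; first exact: exec_loop0.
  apply: (@exec_loopS _ _ b') => //; last by rewrite !addSnnS; apply: IH.
  exact: exec_inc.
have L4 : forall s d, exec (CLoop 1 (CSeq (CInc 3)
     (CSeq (CLoop 1 (CSeq (CInc 4) (CInc 3))) (CLoop 4 (CInc 1)))))
    (store [:: x; s; 0; d; 0; y; w])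
    (store [:: x; 0; 0; triangle s + d; 0; y; w]).
  elim=> [|s IH] d; first exact: exec_loop0.
  apply: (@exec_loopS _ _ s _ [:: x; s; 0; s + d.+1; 0; y; w]) => //.
    apply: exec_seq; first exact: exec_inc.
    apply: exec_seq; first exact: L2.
    by have := L3 s 0 (s + d.+1); rewrite !addn0.
  by rewrite triangleS addnAC -addnA -addSnnS addnC addnC; apply: IH.
have L5 : forall d b, exec (CLoop 3 (CInc 2))
    (store [:: x; 0; b; d; 0; y; w]) (store [:: x; 0; d + b; 0; 0; y; w]).
  elim=> [|b' IH] a'; first exact: exec_loop0.
  apply: (@exec_loopS _ _ b') => //; last by rewrite addSnnS; apply: IH.
  exact: exec_inc.
apply: exec_seq; first exact: L1.
apply: exec_seq; first exact: L4.
by have := L5 (triangle (b + a) + (b + 0)) 0; rewrite !addn0 [b + a]addnC.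
Qed.

Fixpoint incs (r k : nat) (c : cmd) : cmd :=
  if k is k'.+1 then CSeq (CInc r) (incs r k' c) else c.

(** Written with the continuation [c], so [foldl] puts the last constant outermost and pairs it
    first, as [foldr cpair] does. Each constant is loaded by increments, since [pair_cmd] leaves
    register 1 at 0. *)
Definition pairs_cmd (ks : seq nat) (c : cmd) : cmd :=
  foldl (fun c k => incs 1 k (CSeq pair_cmd c)) c ks.

Lemma exec_incs1 k c a x b y w s :
  exec c (store [:: x; k + a; b; 0; 0; y; w]) s ->
  exec (incs 1 k c) (store [:: x; a; b; 0; 0; y; w]) s.
Proof.
elim: k a => //= k IH a; rewrite addSnnS => H.
by apply: XSeq (IH _ H); apply: exec_inc.
Qed.

Lemma exec_incs2 k c a x b y w s :
  exec c (store [:: x; a; k + b; 0; 0; y; w]) s ->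
  exec (incs 2 k c) (store [:: x; a; b; 0; 0; y; w]) s.
Proof.
elim: k b => //= k IH b; rewrite addSnnS => H.
by apply: XSeq (IH _ H); apply: exec_inc.
Qed.

Lemma exec_pairs ks c b x y w s :
  exec c (store [:: x; 0; foldr cpair b ks; 0; 0; y; w]) s ->
  exec (pairs_cmd ks c) (store [:: x; 0; b; 0; 0; y; w]) s.
Proof.
rewrite /pairs_cmd; elim/last_ind: ks b => //= l k IH b.
rewrite foldl_rcons foldr_rcons => H; apply: exec_incs1; rewrite addn0.
by apply: XSeq (exec_pair _ _ _ _ _) _; apply: IH.
Qed.

(* [ks] are the constants paired around the accumulator in each round of
   [iter], so that the command turns [n] into
   [cpair 3 (cpair n (iter n (fun b => foldr cpair b ks) b0))].  Register 1 is 0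
   when [CLoop 1 (CInc 1)] is reached, so this loop does nothing. *)
Definition diag_cmd (b0 : nat) (ks : seq nat) : cmd :=
  CSeq (CLoop 0 (CSeq (CInc 5) (CInc 6)))
  (incs 2 b0 (CSeq (CLoop 5 (pairs_cmd ks (CLoop 1 (CInc 1))))
  (CSeq (CLoop 6 (CInc 1))
  (CSeq pair_cmd
  (pairs_cmd [:: 3] (CLoop 2 (CInc 0))))))).

Lemma exec_diag b0 ks n :
  exec (diag_cmd b0 ks) (store [:: n; 0; 0; 0; 0; 0; 0])
    (store [:: cpair 3 (cpair n (iter n (foldr cpair ^~ ks) b0)); 0; 0; 0; 0; 0; 0]).
Proof.
(* Two copies of the input are needed: register 5 counts the rounds, register 6 keeps [n] for the
   final pairing. *)
have L1 : forall n a b, exec (CLoop 0 (CSeq (CInc 5) (CInc 6)))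
    (store [:: n; 0; 0; 0; 0; a; b]) (store [:: 0; 0; 0; 0; 0; n + a; n + b]).
  elim=> [|m IH] a b; first exact: exec_loop0.
  apply: (@exec_loopS _ _ m) => //; last by rewrite !addSnnS; apply: IH.
  by apply: exec_seq; apply: exec_inc.
have L2 : forall m b, exec (CLoop 5 (pairs_cmd ks (CLoop 1 (CInc 1))))
    (store [:: 0; 0; b; 0; 0; m; n])
    (store [:: 0; 0; iter m (foldr cpair ^~ ks) b; 0; 0; 0; n]).
  elim=> [|m IH] b; first exact: exec_loop0.
  apply: (@exec_loopS _ _ m) => //; last by rewrite iterSr; apply: IH.
  by apply: exec_pairs; apply: exec_loop0.
have L3 : forall m a b, exec (CLoop 6 (CInc 1))
    (store [:: 0; a; b; 0; 0; 0; m]) (store [:: 0; m + a; b; 0; 0; 0; 0]).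
  elim=> [|m IH] a b; first exact: exec_loop0.
  apply: (@exec_loopS _ _ m) => //; last by rewrite addSnnS; apply: IH.
  exact: exec_inc.
have L4 : forall m a, exec (CLoop 2 (CInc 0))
    (store [:: a; 0; m; 0; 0; 0; 0]) (store [:: m + a; 0; 0; 0; 0; 0; 0]).
  elim=> [|m IH] a; first exact: exec_loop0.
  apply: (@exec_loopS _ _ m) => //; last by rewrite addSnnS; apply: IH.
  exact: exec_inc.
apply: exec_seq (L1 _ _ _) _; rewrite addn0.
apply: exec_incs2; rewrite addn0.
apply: exec_seq (L2 _ _) _; apply: exec_seq (L3 _ _ _) _; rewrite addn0.
apply: exec_seq (exec_pair _ _ _ _ _) _; apply: exec_pairs.
by have := L4 (cpair 3 (cpair n (iter n (foldr cpair ^~ ks) b0))) 0; rewrite addn0.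
Qed.

(** This frees register 7 to be the constant zero used by the jumps of the compiled code. *)
Lemma avoids_diag b0 ks : avoids 7 (diag_cmd b0 ks).
Proof.
have incsP r k c : r != 7 -> avoids 7 (incs r k c) = avoids 7 c.
  by move=> r7; elim: k => //= k ->; rewrite r7.
have pairsP l c : avoids 7 (pairs_cmd l c) = avoids 7 c.
  by rewrite /pairs_cmd; elim: l c => //= k l IH c; rewrite IH incsP.
by rewrite /= incsP //= !pairsP.
Qed.

(** Jump targets are cut off at [size P], so that every way of leaving [P] arrives at the first
    instruction after the copy. *)
Definition relocate (o : nat) (P : seq instr) : seq instr :=
  [seq match i with
       | INC r => INC r
       | DEC r j => DEC r (o + minn j (size P))
       end | i <- P].

Lemma relocate_correct P1 P P2 k pc R :
  halted P (iter k (step P) (pc, R)) ->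
  run (P1 ++ relocate (size P1) P ++ P2)
    (size P1 + minn pc (size P), R)
    (size P1 + size P, (iter k (step P) (pc, R)).2).
Proof.
elim: k pc R => [|k IH] pc R.
  by rewrite /halted /= => /minn_idPr ->; apply: run_refl.
case: (leqP (size P) pc) => [h|lt].
  have hc : halted P (pc, R) by [].
  by rewrite halted_iter // => _; apply: run_refl.
rewrite iterSr; case E: (step P (pc, R)) => [pc' R'].
move=> /IH H; apply: run_step; set Q := (P1 ++ _) in H *.
suff -> : step Q (size P1 + pc, R) = (size P1 + minn pc' (size P), R') by [].
have lt' : size P1 + pc < size Q by rewrite /Q !size_cat size_map; lia.
have nthQ : nth (INC 0) Q (size P1 + pc) = nth (INC 0) (relocate (size P1) P) pc.
  by rewrite /Q nth_cat ltnNge leq_addr addKn nth_cat size_map lt.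
move: E; rewrite /step lt lt' nthQ (nth_map (INC 0)) //.
case: (nth _ P pc) => [r|r j]; last case: ifP => _.
- by case=> <- <-; rewrite (minn_idPl lt) addnS.
- by case=> <- <-.
- by case=> <- <-; rewrite (minn_idPl lt) addnS.
Qed.

(** * Encoding a counter machine in the logic *)

Section Cardinal.
Variables (D : Type) (E : D -> D -> Prop).
Hypothesis E_equiv : is_equiv E.

(* [A] meets exactly [n] classes of [E]. *)
Inductive card : (D -> Prop) -> nat -> Prop :=
| card0 A : (forall x, ~ A x) -> card A 0
| cardS A n x : A x -> card (fun y => A y /\ ~ E x y) n -> card A n.+1.

(** The hypotheses say that [T] induces a bijection between the classes met by [A] and those met by
    [B]. The induction removes the class of [x] on one side and that of a partner [y] on the
    other. *)
Lemma card_transfer (T : D -> D -> Prop) A n : card A n -> forall B,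
  (forall a, A a -> exists2 b, B b & T a b) ->
  (forall b, B b -> exists2 a, A a & T a b) ->
  (forall a a' b b', A a -> A a' -> B b -> B b' -> T a b -> T a' b' ->
     (E a a' <-> E b b')) ->
  card B n.
Proof.
elim=> {A n} [A A0|A n x Ax _ IH] B AB BA TE.
  by apply: card0 => b /BA[a /A0].
have [y By Txy] := AB x Ax; apply: (cardS By); apply: IH.
- move=> a [Aa nxa]; have [b Bb Tab] := AB a Aa.
  by exists b => //; split=> //; move/(TE _ _ _ _ Ax Aa By Bb Txy Tab).
- move=> b [Bb nyb]; have [a Aa Tab] := BA b Bb.
  by exists a => //; split=> //; move/(TE _ _ _ _ Ax Aa By Bb Txy Tab).
- by move=> a a' b b' [Aa _] [Aa' _] [Bb _] [Bb' _]; apply: TE.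
Qed.

Lemma card_ext A n B : card A n -> (forall x, A x <-> B x) -> card B n.
Proof.
move=> cA AB; apply: (@card_transfer eq _ _ cA).
- by move=> a /AB Ba; exists a.
- by move=> b /AB Ab; exists b.
- by move=> a a' b b' _ _ _ _ -> ->.
Qed.

(** The classes can be listed in any order: either [x] lies in the class listed first, or the
    removals of these two classes commute. *)
Lemma card_remove A n x : card A n -> A x ->
  exists2 m, n = m.+1 & card (fun y => A y /\ ~ E x y) m.
Proof.
case: E_equiv => _ [symE transE].
move=> cA; elim: cA x => {A n} [A A0 x /A0 //|A n x Ax cAx IH] y Ay.
case: (classic (E x y)) => [Exy|nExy].
  exists n => //; apply: card_ext cAx _ => z.
  split=> -[Az n1]; split=> // E2; apply: n1.
    exact: transE Exy E2.
  exact: transE (symE _ _ Exy) E2.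
have [m -> cAxy] := IH y (conj Ay nExy).
exists m.+1 => //; apply: (@cardS _ _ x); first by split=> // /symE.
by apply: card_ext cAxy _ => z; split=> -[[Az n1] n2].
Qed.

Lemma card0_empty A n : card A n -> (forall x, ~ A x) -> n = 0.
Proof. by case=> // B m x Bx _ /(_ x). Qed.

End Cardinal.

(** * Formulas describing rows, the matching and single instructions *)

Definition Imp (f g : form) : form := Or (Neg f) g.

Lemma imply_or (A B : Prop) : (~ A \/ B) <-> (A -> B).
Proof.
split; first by case.
by case: (classic A) => [a /(_ a) b|na _]; [right | left].
Qed.

Definition Conj (fs : seq form) : form :=
  foldr And (Or (Pred 0 vx) (Neg (Pred 0 vx))) fs.

Definition Odd (v : var) := Pred 0 v.
Definition Start (v : var) := Pred 1 v.
(* State 0 is the loading phase, state [l.+1] is program counter [l]. *)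
Definition State (q : nat) (v : var) := Pred (q.*2).+2 v.
Definition Color (r : nat) (v : var) := Pred (r.*2).+3 v.

(* Rows [2m] and [2m+1] are joined by the [E]'s, rows [2m+1] and [2m+2] by the
   [F]'s; two elements lie in the same row iff they have the same parity and are
   [E2]-related. *)
Definition Link (e f : sym) (v w : var) :=
  Or (And (Neg (Odd v)) (And (Odd w) (Bin e v w)))
     (And (Odd v) (And (Neg (Odd w)) (Bin f v w))).
Definition Same (v w : var) :=
  Or (And (Odd v) (Odd w)) (And (Neg (Odd v)) (Neg (Odd w))).
Definition Row (v w : var) := And (Same v w) (Bin E2 v w).
Definition Succ := Link E2 F2.
Definition TSucc := Link E1 F1.

Definition Iff (f g : form) := And (Imp f g) (Imp g f).

(** A row is entered through one pair of relations and left through the other. Both must partition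
    it alike, so that the matching can be followed from row to row. *)
Definition Agree : form :=
  All vx (All vy (Imp (Same vx vy)
    (And (Iff (Bin E1 vx vy) (Bin F1 vx vy)) (Iff (Bin E2 vx vy) (Bin F2 vx vy))))).

Definition NoStart : form := All vx (All vy (Imp (Succ vx vy) (Neg (Start vy)))).

Definition Fwd (r : nat) : form :=
  All vy (Imp (And (Row vx vy) (Color r vy)) (Ex vx (And (TSucc vy vx) (Color r vx)))).
Definition Bwd (r : nat) : form :=
  All vy (Imp (And (Succ vx vy) (Color r vy)) (Ex vx (And (TSucc vx vy) (Color r vx)))).
Definition Keep (r : nat) : form := And (Fwd r) (Bwd r).
(** Without equality, one new element means one new [E1]-class: [vy] has no coloured predecessor,
    and any coloured element of its row is [E1]-related to it or has one. Once [vx] is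
    re-quantified, the new row is reached as the row of [vy]. *)
Definition IncF (r : nat) : form := And (Fwd r)
  (Ex vy (And (And (Succ vx vy) (Color r vy))
    (And (All vx (Imp (TSucc vx vy) (Neg (Color r vx))))
      (All vx (Imp (And (Row vy vx) (Color r vx))
         (Or (Bin E1 vy vx) (Ex vy (And (TSucc vy vx) (Color r vy))))))))).
Definition DecF (r : nat) : form := And (Bwd r)
  (Ex vy (And (And (Row vx vy) (Color r vy))
    (And (All vx (Imp (TSucc vy vx) (Neg (Color r vx))))
      (All vx (Imp (And (Row vy vx) (Color r vx))
         (Or (Bin E1 vy vx) (Ex vy (And (TSucc vx vy) (Color r vy))))))))).
Definition ZeroF (r : nat) : form :=
  All vy (Imp (Row vx vy) (Neg (Color r vy))).
Definition Next (q : nat) : form := Ex vy (And (Succ vx vy) (State q vy)).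

(** * Meaning of the formulas in a structure *)

Section Semantics.
Variables (D : Type) (M : structure D).
Implicit Types x y z : D.
Local Notation E s := (rel_of M s).

(** These predicates follow the formulas connective by connective, so each [holds] lemma for a
    formula of the encoding is a conversion, if necessary after [imply_or]. *)
Definition odd_in x := pred_of M 0 x.
Definition same_in x y := odd_in x /\ odd_in y \/ ~ odd_in x /\ ~ odd_in y.
Definition row_in x y := same_in x y /\ E E2 x y.
Definition link_in e f x y :=
  ~ odd_in x /\ (odd_in y /\ E e x y) \/ odd_in x /\ (~ odd_in y /\ E f x y).
Definition succ_in := link_in E2 F2.
Definition tsucc_in := link_in E1 F1.
Definition color_in r x := pred_of M (r.*2).+3 x.
Definition state_in q x := pred_of M (q.*2).+2 x.
Definition start_in x := pred_of M 1 x.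

Definition agree_in := forall x y, same_in x y ->
  ((E E1 x y -> E F1 x y) /\ (E F1 x y -> E E1 x y)) /\
  ((E E2 x y -> E F2 x y) /\ (E F2 x y -> E E2 x y)).
Definition no_start_in := forall x y, succ_in x y -> ~ start_in y.
Definition fwd_in r x := forall y, row_in x y /\ color_in r y ->
  exists z, tsucc_in y z /\ color_in r z.
Definition bwd_in r x := forall y, succ_in x y /\ color_in r y ->
  exists z, tsucc_in z y /\ color_in r z.
Definition keep_in r x := fwd_in r x /\ bwd_in r x.
Definition inc_in r x := fwd_in r x /\ exists y,
  (succ_in x y /\ color_in r y) /\ (forall z, tsucc_in z y -> ~ color_in r z) /\
  (forall z, row_in y z /\ color_in r z ->
     E E1 y z \/ exists w, tsucc_in w z /\ color_in r w).
Definition dec_in r x := bwd_in r x /\ exists y,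
  (row_in x y /\ color_in r y) /\ (forall z, tsucc_in y z -> ~ color_in r z) /\
  (forall z, row_in y z /\ color_in r z ->
     E E1 y z \/ exists w, tsucc_in z w /\ color_in r w).
Definition zero_in r x := forall y, row_in x y -> ~ color_in r y.
Definition next_in q x := exists y, succ_in x y /\ state_in q y.

Lemma holds_Agree asg : holds M asg Agree <-> agree_in.
Proof. rewrite /=; do !setoid_rewrite imply_or; exact: iff_refl. Qed.
Lemma holds_NoStart asg : holds M asg NoStart <-> no_start_in.
Proof. rewrite /=; do !setoid_rewrite imply_or; exact: iff_refl. Qed.
Lemma holds_Keep asg r : holds M asg (Keep r) <-> keep_in r (asg vx).
Proof. rewrite /=; do !setoid_rewrite imply_or; exact: iff_refl. Qed.
Lemma holds_IncF asg r : holds M asg (IncF r) <-> inc_in r (asg vx).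
Proof. rewrite /=; do !setoid_rewrite imply_or; exact: iff_refl. Qed.
Lemma holds_DecF asg r : holds M asg (DecF r) <-> dec_in r (asg vx).
Proof. rewrite /=; do !setoid_rewrite imply_or; exact: iff_refl. Qed.
Lemma holds_ZeroF asg r : holds M asg (ZeroF r) <-> zero_in r (asg vx).
Proof. rewrite /=; do !setoid_rewrite imply_or; exact: iff_refl. Qed.
Lemma holds_Next asg q : holds M asg (Next q) <-> next_in q (asg vx).
Proof. exact: iff_refl. Qed.

Lemma holds_Conj asg (T : eqType) (s : seq T) (F : T -> form) :
  holds M asg (Conj [seq F i | i <- s]) <-> forall i, i \in s -> holds M asg (F i).
Proof.
elim: s => [|a s IH] /=; first by split=> // _; apply: classic.
rewrite -/(Conj _) IH; split=> [[Ha Hs] i|H].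
  by rewrite inE => /orP[/eqP -> //|/Hs].
by split=> [|i si]; apply: H; rewrite inE ?eqxx ?si ?orbT.
Qed.

(** * Rows, the matching between them, and register values *)

Hypotheses (admM : admissible M) (agree : agree_in).

Lemma row_equiv : is_equiv row_in.
Proof.
case: admM => /(_ E2)[refl [sym trans]] _; split=> [x|].
  by split=> //; case: (classic (odd_in x)); [left | right].
split=> [x y [s e]|x y z [s1 e1] [s2 e2]].
  split; last exact: sym.
  by case: s => -[? ?]; [left | right].
split; last exact: trans e1 e2.
by case: s1 s2 => -[? ?] [] [? ?] //; [left | right].
Qed.

Lemma agree1 x y : same_in x y -> E E1 x y <-> E F1 x y.
Proof. by move=> /agree[[a b] [c d]]. Qed.

Lemma agree2 x y : same_in x y -> E E2 x y <-> E F2 x y.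
Proof. by move=> /agree[[a b] [c d]]. Qed.

Lemma tsucc_succ x y : tsucc_in x y -> succ_in x y.
Proof.
case: admM => _ [hE hF].
by case=> -[a [b c]]; [left | right]; do ?split => //; [apply: hE | apply: hF].
Qed.

Lemma succ_row x y z : succ_in x y -> row_in y z -> succ_in x z.
Proof.
case: admM => eqv _; have [_ [_ tE]] := eqv E2; have [_ [_ tF]] := eqv F2.
case=> -[a [b c]] [s e]; [left | right]; do 2![split=> //].
- by case: s => -[].
- exact: tE c e.
- by case: s => -[].
- by apply: tF c _; apply/agree2.
Qed.

Lemma succ_succ x y z : succ_in x y -> succ_in x z -> row_in y z.
Proof.
case: admM => eqv _; have [_ [sE tE]] := eqv E2; have [_ [sF tF]] := eqv F2.
case=> -[a [b c]] [] [a' [b' c']] //.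
  by split; [left | apply: tE (sE _ _ c) c'].
have s : same_in y z by right.
by split=> //; apply/(agree2 s); apply: tF (sF _ _ c) c'.
Qed.

Lemma succ_pred x y z : succ_in x z -> succ_in y z -> row_in x y.
Proof.
case: admM => eqv _; have [_ [sE tE]] := eqv E2; have [_ [sF tF]] := eqv F2.
case=> -[a [b c]] [] [a' [b' c']] //.
  by split; [right | apply: tE c (sE _ _ c')].
have s : same_in x y by left.
by split=> //; apply/(agree2 s); apply: tF c (sF _ _ c').
Qed.

Lemma row_succ x y z : row_in x y -> succ_in y z -> succ_in x z.
Proof.
case: admM => eqv _; have [_ [_ tE]] := eqv E2; have [_ [_ tF]] := eqv F2.
move=> [s e] [] [a [b c]]; [left | right]; split.
- by case: s => -[].
- by split=> //; apply: tE e c.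
- by case: s => -[].
- by split=> //; apply: tF c; apply/agree2.
Qed.

(** Matched elements share an [E1]-class or an [F1]-class, according to parity; in the second case
    [agree1] translates at both ends. Hence the matching is well defined and injective on the
    [E1]-classes of a row. *)
Lemma tsucc_inj x x' y y' :
  tsucc_in x y -> tsucc_in x' y' -> row_in x x' -> (E E1 x x' <-> E E1 y y').
Proof.
case: admM => eqv _; have [_ [sE tE]] := eqv E1; have [_ [sF tF]] := eqv F1.
move=> xy x'y' xx'.
have yy' : row_in y y'.
  by apply: succ_succ (tsucc_succ xy) (row_succ xx' (tsucc_succ x'y')).
case: xx' yy' => s _ [s' _].
case: xy x'y' => -[a [b c]] [] [a' [b' c']]; try by case: s => -[].
  split=> e; first exact: tE (sE _ _ c) (tE _ _ _ e c').
  exact: tE c (tE _ _ _ e (sE _ _ c')).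
rewrite (agree1 s) (agree1 s').
split=> e; first exact: tF (sF _ _ c) (tF _ _ _ e c').
exact: tF c (tF _ _ _ e (sF _ _ c')).
Qed.

Lemma tsucc_E1 x y y' : tsucc_in x y -> row_in y y' -> E E1 y y' -> tsucc_in x y'.
Proof.
case: admM => eqv _; have [_ [_ tE]] := eqv E1; have [_ [_ tF]] := eqv F1.
move=> [] [a [b c]] [s _] e; [left | right]; do 2![split=> //].
- by case: s => -[].
- exact: tE c e.
- by case: s => -[].
- by apply: tF c _; apply/agree1.
Qed.

Lemma E1_tsucc x x' y : row_in x x' -> E E1 x x' -> tsucc_in x' y -> tsucc_in x y.
Proof.
case: admM => eqv _; have [_ [_ tE]] := eqv E1; have [_ [_ tF]] := eqv F1.
move=> [s _] e [] [a [b c]]; [left | right]; split.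
- by case: s => -[].
- by split=> //; apply: tE e c.
- by case: s => -[].
- by split=> //; apply: tF c; apply/agree1.
Qed.

(** The register value is a number of [E1]-classes, not of elements, because elements of one class
    in a row cannot be told apart by the matching. *)
Definition counts r x := card (E E1) (fun y => row_in x y /\ color_in r y).

Let E1_equiv : is_equiv (E E1). Proof. by case: admM. Qed.
Let row_refl := proj1 row_equiv.
Let row_sym := proj1 (proj2 row_equiv).
Let row_trans := proj2 (proj2 row_equiv).

Lemma counts_row r x y n : row_in x y -> counts r x n -> counts r y n.
Proof.
move=> xy /card_ext; apply=> z; split=> -[a b]; split=> //.
  exact: row_trans (row_sym xy) a.
exact: row_trans xy a.
Qed.

Lemma zero_counts r x : zero_in r x -> counts r x 0.
Proof. by move=> z; apply: card0 => y [/z]. Qed.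

Lemma zero_count r x n : zero_in r x -> counts r x n -> n = 0.
Proof. by move=> zx cx; apply: card0_empty cx _ => y [/zx]. Qed.

Lemma fwd_succ r x x' y : fwd_in r x -> succ_in x x' ->
  row_in x y /\ color_in r y ->
  exists2 z, row_in x' z /\ color_in r z & tsucc_in y z.
Proof.
move=> f xx' [xy cy]; have [z [yz cz]] := f y (conj xy cy).
by exists z => //; split=> //; apply: succ_succ xx' (row_succ xy (tsucc_succ yz)).
Qed.

Lemma pred_row r x x' y z : succ_in x x' -> row_in x' y ->
  tsucc_in z y /\ color_in r z -> row_in x z /\ color_in r z.
Proof.
move=> xx' x'y [zy cz]; split=> //.
exact: succ_pred (succ_row xx' x'y) (tsucc_succ zy).
Qed.

Lemma bwd_pred r x x' y : bwd_in r x -> succ_in x x' ->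
  row_in x' y /\ color_in r y ->
  exists2 z, row_in x z /\ color_in r z & tsucc_in z y.
Proof.
move=> f xx' [xy cy]; have [z zy] := f y (conj (succ_row xx' xy) cy).
by exists z; [apply: pred_row xx' xy zy | case: zy].
Qed.

Lemma tsucc_row_inj x a a' b b' :
  row_in x a -> row_in x a' -> tsucc_in a b -> tsucc_in a' b' ->
  (E E1 a a' <-> E E1 b b').
Proof.
move=> xa xa' ab a'b'; apply: tsucc_inj ab a'b' _.
exact: row_trans (row_sym xa) xa'.
Qed.

Lemma keep_counts r x x' n :
  keep_in r x -> succ_in x x' -> counts r x n -> counts r x' n.
Proof.
move=> [f b] xx' cx; apply: (card_transfer (T := tsucc_in) cx).
- by move=> y /(fwd_succ f xx').
- by move=> y /(bwd_pred b xx').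
- by move=> a a' c c' [ra _] [ra' _] _ _; apply: tsucc_row_inj ra ra'.
Qed.

Lemma inc_counts r x x' n :
  inc_in r x -> succ_in x x' -> counts r x n -> counts r x' n.+1.
Proof.
case: (E1_equiv) => _ [sE _].
move=> [f [y [[xy cy] [ny oy]]]] xx' cx.
have x'y := succ_succ xx' xy.
apply: (@cardS _ _ _ _ y) => //; apply: (card_transfer (T := tsucc_in) cx).
- move=> z rz; have [w [xw cw] zw] := fwd_succ f xx' rz.
  (* If the successor [w] were in the class of the new element [y], then [z] would be a coloured
     predecessor of [y]. *)
  exists w => //; split=> // yw; apply: (ny z) (proj2 rz).
  by apply: tsucc_E1 zw _ (sE _ _ yw); apply: row_trans (row_sym xw) x'y.
- move=> z [[x'z cz] nyz].
  case: (oy z (conj (row_trans (row_sym x'y) x'z) cz)) => // -[w wz].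
  by exists w; [apply: pred_row xx' x'z wz | case: wz].
- by move=> a a' c c' [ra _] [ra' _] _ _; apply: tsucc_row_inj ra ra'.
Qed.

Lemma dec_counts r x x' n :
  dec_in r x -> succ_in x x' -> counts r x n -> exists2 m, n = m.+1 & counts r x' m.
Proof.
move=> [b [y [[xy cy] [ny oy]]]] xx' cx.
have [m -> cm] := card_remove E1_equiv cx (conj xy cy).
exists m => //; apply: (card_transfer (T := tsucc_in) cm).
- move=> z [[xz cz] nyz].
  case: (oy z (conj (row_trans (row_sym xy) xz) cz)) => // -[w [zw cw]].
  by exists w => //; split=> //; apply: succ_succ xx' (row_succ xz (tsucc_succ zw)).
- move=> z rz; have [w [xw cw] wz] := bwd_pred b xx' rz.
  exists w => //; split=> // yw; apply: (ny z) (proj2 rz).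
  by apply: E1_tsucc _ yw wz; apply: row_trans (row_sym xy) xw.
- by move=> a a' c c' [[ra _] _] [[ra' _] _] _ _; apply: tsucc_row_inj ra ra'.
Qed.

End Semantics.

(** * The formula of a machine and its input *)

Definition instr_reg (i : instr) : nat := match i with INC r => r | DEC r _ => r end.

(** Always positive, so register 0, which receives the input, is tracked even by a program that
    never names it. *)
Definition nregs (P : seq instr) : nat := (\max_(i <- P) instr_reg i).+1.

Definition Keeps (N r : nat) : form := Conj [seq Keep i | i <- iota 0 N & i != r].

(* With [b] set, jumping out of the program is forbidden. *)
Definition Goto (b : bool) (P : seq instr) (l : nat) : form :=
  if b && (size P <= l) then And (Odd vx) (Neg (Odd vx)) else Next l.+1.

Definition Trans (b : bool) (P : seq instr) (l : nat) : form :=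
  match nth (INC 0) P l with
  | INC r => And (Goto b P l.+1) (And (IncF r) (Keeps (nregs P) r))
  | DEC r j =>
      Or (And (ZeroF r) (And (Goto b P j) (Conj [seq Keep i | i <- iota 0 (nregs P)])))
         (And (Goto b P l.+1) (And (DecF r) (Keeps (nregs P) r)))
  end.

(** The input is absent here and enters only through [Init]; the formula depends on the machine
    alone, so its code can be given to that machine as input. Only the last two conjuncts constrain
    the free [vx], an element of the first row. *)
Definition Base (b : bool) (P : seq instr) : form :=
  And Agree (And NoStart
  (And (All vx (Imp (State 0 vx) (And (IncF 0) (Keeps (nregs P) 0))))
  (And (Conj [seq All vx (Imp (State l.+1 vx) (Trans b P l)) | l <- iota 0 (size P)])
  (And (Start vx) (Conj [seq ZeroF r | r <- iota 0 (nregs P)]))))).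

(* Forces [n] loading rows, each of which increments register 0, before the row
   in which the program starts. *)
Definition Init (n : nat) : form :=
  iter n (fun g => And (State 0 vx)
    (Ex vy (And (Succ vx vy) (Ex vx (And (Row vy vx) g))))) (State 1 vx).

(** Each loading row wraps the formula in the same connectives, so its code is paired with the same
    constants: tags 3 and 5 for [And] and [Ex], 1 and 0 for [vy] and [vx]. This is the iteration
    that [diag_cmd] computes. *)
Lemma code_Init :
  exists b0 ks, forall n, code (Init n) = iter n (foldr cpair ^~ ks) b0.
Proof.
have code_iter a c d e n :
    code (iter n (fun g => And a (Ex vy (And c (Ex vx (And d g))))) e)
    = iter n (foldr cpair ^~ [:: 3; code a; 5; 1; 3; code c; 5; 0; 3; code d]) (code e).
  by elim: n => // n IH; rewrite [in RHS]iterS -IH.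
exact: ex_intro _ _ (ex_intro _ _
  (code_iter (State 0 vx) (Succ vx vy) (Row vy vx) (State 1 vx))).
Qed.

Lemma nregs_gt (P : seq instr) l : l < size P -> instr_reg (nth (INC 0) P l) < nregs P.
Proof.
rewrite /nregs ltnS; elim: P l => //= i P IH [|l] lP; rewrite big_cons leq_max.
  by rewrite leqnn.
by rewrite IH ?orbT.
Qed.

Section Program.
Variables (D : Type) (M : structure D) (b : bool) (P : seq instr).
Implicit Types x y z : D.

Definition keeps_in r x := forall i, i < nregs P -> i != r -> keep_in M i x.
Definition goto_in l x := if b && (size P <= l) then False else next_in M l.+1 x.
Definition trans_in l x :=
  match nth (INC 0) P l with
  | INC r => goto_in l.+1 x /\ inc_in M r x /\ keeps_in r x
  | DEC r j =>
      zero_in M r x /\ goto_in j x /\ (forall i, i < nregs P -> keep_in M i x) \/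
      goto_in l.+1 x /\ dec_in M r x /\ keeps_in r x
  end.
Definition base_in x :=
  agree_in M /\ no_start_in M /\
  (forall y, state_in M 0 y -> inc_in M 0 y /\ keeps_in 0 y) /\
  (forall l, l < size P -> forall y, state_in M l.+1 y -> trans_in l y) /\
  start_in M x /\ (forall r, r < nregs P -> zero_in M r x).
Fixpoint init_in n x :=
  if n is n'.+1 then
    state_in M 0 x /\
    exists y, succ_in M x y /\ exists z, row_in M y z /\ init_in n' z
  else state_in M 1 x.

Lemma holds_AllImp asg f g (F G : D -> Prop) :
  (forall y, holds M (upd asg vx y) f <-> F y) ->
  (forall y, holds M (upd asg vx y) g <-> G y) ->
  (holds M asg (All vx (Imp f g)) <-> forall y, F y -> G y).
Proof.
move=> fF gG; rewrite /=; setoid_rewrite imply_or.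
by split=> H y; [move=> /fF /H /gG | move=> /fF /H /gG].
Qed.

Lemma holds_Keeps asg r : holds M asg (Keeps (nregs P) r) <-> keeps_in r (asg vx).
Proof.
rewrite holds_Conj; split=> H i.
  by move=> iN ir; apply/(holds_Keep M asg); apply: H; rewrite mem_filter ir mem_iota.
rewrite mem_filter mem_iota => /andP[ir iN].
by apply/holds_Keep; apply: H.
Qed.

Lemma holds_iota asg N F (G : nat -> Prop) :
  (forall i, i < N -> (holds M asg (F i) <-> G i)) ->
  holds M asg (Conj [seq F i | i <- iota 0 N]) <-> forall i, i < N -> G i.
Proof.
move=> FG; rewrite holds_Conj; split=> H i iN.
  by apply/FG => //; apply: H; rewrite mem_iota.
by move: iN; rewrite mem_iota => iN; apply/FG => //; apply: H.
Qed.

Lemma holds_Goto asg l : holds M asg (Goto b P l) <-> goto_in l (asg vx).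
Proof.
rewrite /Goto /goto_in; case: ifP => _; last exact: holds_Next.
by split=> // -[].
Qed.

Lemma holds_And asg f g F G : (holds M asg f <-> F) -> (holds M asg g <-> G) ->
  (holds M asg (And f g) <-> F /\ G).
Proof. by move=> fF gG; rewrite /= fF gG. Qed.

Lemma holds_Or asg f g F G : (holds M asg f <-> F) -> (holds M asg g <-> G) ->
  (holds M asg (Or f g) <-> F \/ G).
Proof. by move=> fF gG; rewrite /= fF gG. Qed.

Lemma holds_Trans asg l : holds M asg (Trans b P l) <-> trans_in l (asg vx).
Proof.
rewrite /Trans /trans_in; case: nth => [r|r j].
  exact: holds_And (holds_Goto _ _) (holds_And (holds_IncF _ _ _) (holds_Keeps _ _)).
apply: holds_Or; last first.
  exact: holds_And (holds_Goto _ _) (holds_And (holds_DecF _ _ _) (holds_Keeps _ _)).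
apply: holds_And (holds_ZeroF _ _ _) (holds_And (holds_Goto _ _) _).
by apply: (holds_iota (G := fun i => keep_in M i (asg vx))) => i _; apply: holds_Keep.
Qed.

Lemma holds_Base asg : holds M asg (Base b P) <-> base_in (asg vx).
Proof.
apply: holds_And (holds_Agree _ _) _; apply: holds_And (holds_NoStart _ _) _.
apply: holds_And.
  apply: holds_AllImp => y; first exact: iff_refl.
  exact: holds_And (holds_IncF _ _ _) (holds_Keeps _ _).
apply: holds_And; last first.
  apply: holds_And; first exact: iff_refl.
  by apply: (holds_iota (G := fun r => zero_in M r (asg vx))) => i _; apply: holds_ZeroF.
apply: (holds_iota (G := fun l => forall y, state_in M l.+1 y -> trans_in l y)) => l _.
by apply: holds_AllImp => y; [apply: iff_refl | apply: holds_Trans].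
Qed.

Lemma holds_Init asg n : holds M asg (Init n) <-> init_in n (asg vx).
Proof.
elim: n asg => [|n IH] asg; first exact: iff_refl.
split=> /= -[s0 [y [xy [z [yz H]]]]]; split=> //; exists y; split=> //.
  by exists z; split=> //; move/IH: H.
by exists z; split=> //; apply/IH.
Qed.

(** * From a model to a run of the machine *)

Section Soundness.
Variable x0 : D.
Hypotheses (admM : admissible M) (base0 : base_in x0).

Let agree : agree_in M := proj1 base0.

Definition counted x (R : nat -> nat) := forall r, r < nregs P -> counts M r x (R r).

Definition chain m (f : nat -> D) := f 0 = x0 /\ forall i, i < m -> succ_in M (f i) (f i.+1).

Definition reached m x := exists2 f, chain m f & f m = x.

Lemma reachedS m x y : reached m x -> succ_in M x y -> reached m.+1 y.
Proof.
move=> [f [f0 fS] fm] xy; exists (fun i => if i <= m then f i else y); last by rewrite ltnn.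
split=> //= i; rewrite ltnS => im; rewrite im.
by case: ltngtP im => // [lt _|-> _]; [apply: fS | rewrite fm].
Qed.

(** Equal rows have equal predecessor rows, so a repetition can be shifted back until it involves
    the row of [x0], which would then have a predecessor against [no_start_in]. *)
Lemma chain_rows m f i j : chain m f -> i < j -> j <= m -> ~ row_in M (f i) (f j).
Proof.
move=> [f0 fS]; elim: i j => [|i IH] [//|j] ij jm rij.
all: have [_ [row_sym _]] := row_equiv admM.
  case: base0 => _ [noS [_ [_ [st _]]]].
  by apply: (noS (f j) x0 _ st); rewrite -f0; apply: succ_row (fS j jm) (row_sym _ _ rij).
apply: (IH j) => //; first exact: ltnW.
apply: (@succ_pred _ _ admM agree _ _ (f j.+1)); last exact: fS.
by apply: succ_row rij => //; apply: fS; lia.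
Qed.

Lemma counted_keeps x y R r v : succ_in M x y -> counted x R -> keeps_in r x ->
  counts M r y v -> counted y (setreg R r v).
Proof.
move=> xy cx kx cy i iN; rewrite /setreg; case: eqP => [->//|/eqP ir].
by apply: keep_counts (kx i iN ir) xy (cx i iN).
Qed.

Lemma load_sound n m x R : reached m x -> init_in n x -> counted x R ->
  exists m' y, reached m' y /\ state_in M 1 y /\ counted y (setreg R 0 (R 0 + n)).
Proof.
elim: n m x R => [|n IH] m x R mx.
  move=> s1 cx; exists m, x; split=> //; split=> // r rN; rewrite addn0 /setreg.
  by case: eqP => [<-|_]; apply: cx.
move=> [s0 [y [xy [z [yz iz]]]]] cx.
have xz : succ_in M x z by apply: succ_row xy yz.
case: base0 => _ [_ [/(_ x s0)[ix kx] _]].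
have cz : counted z (setreg R 0 (R 0).+1).
  by apply: (counted_keeps xz cx kx); apply: inc_counts ix xz (cx 0 _).
have [m' [w [mw [sw cw]]]] := IH _ _ _ (reachedS mx xz) iz cz.
exists m', w; do 2![split=> //]; move=> r /cw.
by rewrite /setreg eqxx addSnnS; case: eqP.
Qed.

Lemma goto_next l x : goto_in l x ->
  (b -> l < size P) /\ exists2 y, succ_in M x y & state_in M l.+1 y.
Proof.
rewrite /goto_in; case: b; rewrite /= ?ltnNge; last by move=> [y []]; split=> //; exists y.
by case: leqP => // lt [y []]; split=> //; exists y.
Qed.

(** At a [DEC], the disjunct that holds is the branch the machine takes: [zero_in] forces the value
    0 and [dec_in] a positive one. *)
Lemma step_sound x c : counted x c.2 -> ~~ halted P c -> state_in M c.1.+1 x ->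
  exists2 y, succ_in M x y &
    (b -> (step P c).1 < size P) /\ state_in M (step P c).1.+1 y /\
    counted y (step P c).2.
Proof.
case: c => pc R /= cx; rewrite /halted -ltnNge /= => lt sx.
rewrite lt; case: base0 => _ [_ [_ [/(_ pc lt x sx)]]].
have := nregs_gt lt; rewrite /trans_in; case: nth => [r|r j] /= rN.
  move=> [/goto_next[bl [y xy sy]] [ix kx]] _; exists y => //; do 2![split=> //].
  by apply: (counted_keeps xy cx kx); apply: inc_counts ix xy (cx r rN).
case.
  move=> [zx [/goto_next[bl [y xy sy]] kx]] _.
  rewrite (zero_count zx (cx r rN)) eqxx /=; exists y => //; do 2![split=> //].
  by move=> i iN; apply: keep_counts (kx i iN) xy (cx i iN).
move=> [/goto_next[bl [y xy sy]] [dx kx]] _.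
have [m Rr cy] := dec_counts admM agree dx xy (cx r rN).
rewrite Rr /=; exists y => //; do 2![split=> //].
exact: counted_keeps xy cx kx _.
Qed.

Hypothesis P_gt0 : 0 < size P.

(** Serves both problems. With [b] set, the absence of a halt is a conclusion; otherwise it is
    assumed, and the gain is a chain of length at least [k] for every [k]. [P_gt0] covers the
    initial program counter, which no [Goto] guards. *)
Lemma run_sound n : init_in n x0 ->
  (~~ b -> forall k, ~~ halted P (iter k (step P) (init n))) ->
  forall k, exists m y, k <= m /\ reached m y /\
    state_in M (iter k (step P) (init n)).1.+1 y /\
    counted y (iter k (step P) (init n)).2 /\
    ~~ halted P (iter k (step P) (init n)).
Proof.
move=> i0 nh; elim=> [|k [m [x [km [mx [sx [cx hx]]]]]]].
  have r0 : reached 0 x0 by exists (fun=> x0).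
  have c0 : counted x0 (fun=> 0).
    by move=> r rN; case: base0 => _ [_ [_ [_ [_ z0]]]]; apply: zero_counts (z0 r rN).
  have [m [y [my [sy cy]]]] := load_sound r0 i0 c0.
  by exists m, y; do 4![split=> //]; rewrite /halted -ltnNge.
have [y xy [bl [sy cy]]] := step_sound cx hx sx.
exists m.+1, y; split=> //; split; first exact: reachedS mx xy.
do 2![split=> //].
by case: (boolP b) => [/bl lt|/nh]; [rewrite /halted -ltnNge | apply].
Qed.

End Soundness.
End Program.

Lemma Base_Init_nonhalting P n : 0 < size P ->
  satisfiable (And (Base true P) (Init n)) ->
  forall k, ~~ halted P (iter k (step P) (init n)).
Proof.
move=> P0 [D [M [asg [adm [/holds_Base B /holds_Init I]]]]] k.
by have [m [y [_ [_ [_ []]]]]] := run_sound adm B P0 I (fun e => match notF e with end) k.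
Qed.

(** Pigeonhole: an endless run would give a chain of more than [#|D|] elements, which are distinct
    because their rows are. *)
Lemma Base_Init_halting P n : 0 < size P ->
  fin_satisfiable (And (Base false P) (Init n)) ->
  ~ forall k, ~~ halted P (iter k (step P) (init n)).
Proof.
move=> P0 [D [M [asg [adm [/holds_Base B /holds_Init I]]]]] nh.
have [m [y [Dm [[f fc _] _]]]] := run_sound adm B P0 I (fun _ => nh) #|D|.
have row_refl := proj1 (row_equiv adm).
suff inj : injective (fun i : 'I_m.+1 => f i).
  by have := leq_card _ inj; rewrite card_ord ltnNge Dm.
move=> i j fij; apply: val_inj => /=.
have [im jm] : i <= m /\ j <= m by split; rewrite -ltnS.
case: (ltngtP i j) => // lt; [case: (chain_rows adm B fc lt jm) |
  case: (chain_rows adm B fc lt im)]; by rewrite fij; apply: row_refl.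
Qed.

(** * From a run of the machine to a grid model *)

Section Completeness.
Variables (b : bool) (P : seq instr) (n : nat).

(* The loading phase followed by the run of [P] on input [n]; a control state
   is 0 while loading and the successor of the program counter afterwards. *)
Definition trace (i : nat) : config :=
  if i < n then (0, (init i).2)
  else let c := iter (i - n) (step P) (init n) in (c.1.+1, c.2).

Definition active (i : nat) : bool :=
  (i < n) || ~~ halted P (iter (i - n) (step P) (init n)).

Lemma trace_step i : n <= i ->
  trace i.+1 = let c := step P ((trace i).1.-1, (trace i).2) in (c.1.+1, c.2).
Proof.
move=> ni; rewrite /trace !ltnNge ni (leqW ni) /= subSn //=.
by case: (iter _ _ _).
Qed.

Lemma trace_load i : i < n -> (trace i.+1).2 = setreg (trace i).2 0 ((trace i).2 0).+1.
Proof.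
move=> lt; have -> : (trace i.+1).2 = (init i.+1).2.
  by rewrite /trace; case: (ltngtP i.+1 n) lt => [//|lt1 lt2|<- _]; [lia | rewrite subnn].
rewrite /trace lt; apply: functional_extensionality => r.
by rewrite /setreg /=; case: eqP.
Qed.

Lemma trace_bound i r : (trace i).2 r <= i.
Proof.
elim: i r => [|i IH] r.
  by rewrite /trace; case: n => [|m] /=; case: eqP.
case: (ltnP i n) => [lt|ge].
  by rewrite trace_load // /setreg; case: eqP => _; rewrite ?ltnS ?leqW.
rewrite trace_step //; move: IH; case: (trace i) => q R /= IHi.
case: ifP => _; last exact: leqW.
case: nth => [r'|r' j] /=; first by rewrite /setreg; case: eqP => _; rewrite ?ltnS ?leqW.
case: eqP => _ /=; first exact: leqW.
rewrite /setreg; case: eqP => _; last exact: leqW.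
by apply: leq_trans (leq_pred _) _; apply: leqW.
Qed.

Variables (D : Type) (t k : D -> nat) (K : pred nat).
Hypothesis full : forall x j, K j -> exists y, t y = t x /\ k y = j.
Hypothesis next : forall x j, active (t x) -> K j -> exists y, t y = (t x).+1 /\ k y = j.
Hypothesis Kk : forall x, K (k x).
Hypothesis KR : forall x r j, j < (trace (t x)).2 r -> K j.
Hypothesis nonhalting : b -> forall i, ~~ halted P (iter i (step P) (init n)).

Definition model : structure D := Structure
  (fun p x => match p return Prop with
    | 0 => odd (t x)
    | 1 => t x = 0
    | q.+2 => if odd q then is_true (k x < (trace (t x)).2 q./2) else (trace (t x)).1 = q./2
    end)
  (fun s x y => match s with
    | E1 => (t x)./2 = (t y)./2 /\ k x = k y
    | E2 => (t x)./2 = (t y)./2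
    | F1 => uphalf (t x) = uphalf (t y) /\ k x = k y
    | F2 => uphalf (t x) = uphalf (t y)
    end).

Lemma model_admissible : admissible model.
Proof.
split; last by split=> a c [].
case; (split; first by []); split=> [x y|x y z] /=.
- by case=> -> ->.
- by case=> -> -> [-> ->].
- by move=> ->.
- by move=> -> ->.
- by case=> -> ->.
- by case=> -> -> [-> ->].
- by move=> ->.
- by move=> -> ->.
Qed.

Lemma model_row x y : row_in model x y <-> t x = t y.
Proof. rewrite /row_in /same_in /odd_in /=; lia. Qed.

Lemma model_succ x y : succ_in model x y <-> t y = (t x).+1.
Proof. rewrite /succ_in /link_in /odd_in /= !uphalf_half; lia. Qed.

Lemma model_tsucc x y : tsucc_in model x y <-> t y = (t x).+1 /\ k x = k y.
Proof. rewrite /tsucc_in /link_in /odd_in /= !uphalf_half; lia. Qed.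

Lemma model_color r x : color_in model r x <-> k x < (trace (t x)).2 r.
Proof. by rewrite /color_in /= odd_double uphalf_double. Qed.

Lemma model_state q x : state_in model q x <-> (trace (t x)).1 = q.
Proof. by rewrite /state_in /= odd_double doubleK. Qed.

Lemma model_agree : agree_in model.
Proof. rewrite /agree_in /same_in /odd_in /= => x y; rewrite !uphalf_half; lia. Qed.

Lemma model_fwd r x : active (t x) ->
  (trace (t x)).2 r <= (trace (t x).+1).2 r -> fwd_in model r x.
Proof.
move=> act le y [/model_row xy /model_color cy].
have [|z [tz kz]] := @next y (k y) _ (Kk y); first by rewrite -xy.
exists z; rewrite model_tsucc model_color tz kz; do ?split => //.
by move: cy; rewrite -xy => /leq_trans; apply.
Qed.

Lemma model_bwd r x : (trace (t x).+1).2 r <= (trace (t x)).2 r -> bwd_in model r x.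
Proof.
move=> le y [/model_succ xy /model_color cy].
have [z [tz kz]] := full x (Kk y).
exists z; rewrite model_tsucc model_color tz kz; do ?split => //.
by move: cy; rewrite xy => /leq_trans; apply.
Qed.

Lemma model_keep r x : active (t x) ->
  (trace (t x).+1).2 r = (trace (t x)).2 r -> keep_in model r x.
Proof. by move=> act e; split; [apply: model_fwd | apply: model_bwd]; rewrite ?e. Qed.

Lemma model_inc r x : active (t x) ->
  (trace (t x).+1).2 r = ((trace (t x)).2 r).+1 -> inc_in model r x.
Proof.
move=> act e; split; first by apply: model_fwd; rewrite ?e.
have [x' [tx' _]] := next act (Kk x).
have [|y [ty ky]] := @full x' ((trace (t x)).2 r).
  by apply: (@KR x' r); rewrite tx' e.
exists y; rewrite model_succ model_color ty tx' ky e; split=> //; split=> z.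
  rewrite model_tsucc model_color ty tx' => -[[<-] ->]; rewrite ky.
  by rewrite ltnn.
rewrite model_row model_color => -[tz]; rewrite -tz ty tx' e ltnS leq_eqVlt.
case/orP => [/eqP kz|kz]; [left | right]; first by rewrite /= tz kz.
have [w [tw kw]] := full x (Kk z); exists w.
by rewrite model_tsucc model_color tw kw -tz ty tx'.
Qed.

Lemma model_dec r x : active (t x) ->
  (trace (t x)).2 r = ((trace (t x).+1).2 r).+1 -> dec_in model r x.
Proof.
move=> act e; split; first by apply: model_bwd; rewrite e.
have [|y [ty ky]] := @full x ((trace (t x).+1).2 r).
  by apply: (@KR x r); rewrite e.
exists y; rewrite model_row model_color ty ky e; split=> //; split=> z.
  by rewrite model_tsucc model_color ty => -[-> <-]; rewrite ky ltnn.
rewrite model_row model_color => -[tz]; rewrite -tz ty e ltnS leq_eqVlt.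
case/orP => [/eqP kz|kz]; [left | right]; first by rewrite /= tz kz ky.
have [w [tw kw]] := next act (Kk z); exists w.
by rewrite model_tsucc model_color tw kw -tz ty.
Qed.

Lemma model_goto l x : n <= t x -> active (t x) -> (trace (t x).+1).1 = l.+1 ->
  goto_in model b P l x.
Proof.
move=> nx act e; have [y [ty _]] := next act (Kk x).
have xy : next_in model l.+1 x by exists y; rewrite model_succ model_state ty.
rewrite /goto_in; case: ifP => // /andP[/nonhalting /(_ (t x - n).+1) nh].
move: e; rewrite /trace ltnNge (leqW nx) /= subSn // => -[e] le.
by move: nh; rewrite /halted e le.
Qed.

Lemma model_base x0 : t x0 = 0 -> base_in model b P x0.
Proof.
move=> tx0; split; first exact: model_agree.
split; first by move=> x y /model_succ ty; rewrite /start_in /= ty.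
split.
  move=> x /model_state s0.
  have lt : t x < n by move: s0; rewrite /trace; case: ltnP.
  have act : active (t x) by rewrite /active lt.
  split; first by apply: model_inc; rewrite // trace_load.
  by move=> i _ i0; apply: model_keep; rewrite // trace_load // /setreg (negbTE i0).
split; last first.
  split=> // r _ y /model_row tyE /model_color; rewrite -tyE tx0.
  by have := trace_bound 0 r; rewrite leqn0 => /eqP ->.
move=> l lP x /model_state sx.
have nx : n <= t x by move: sx; rewrite /trace; case: ltnP.
have act : active (t x).
  move: sx; rewrite /trace /active ltnNge nx /= => -[sx].
  by rewrite /halted sx -ltnNge.
have et := trace_step nx; rewrite sx /= lP in et.
move: (congr1 fst et) (congr1 snd et); rewrite /trans_in.
case: nth => [r|r j] /=.
  move=> eq eR; split; first exact: model_goto.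
  split; first by apply: model_inc; rewrite // eR /setreg eqxx.
  by move=> i _ ir; apply: model_keep; rewrite // eR /setreg (negbTE ir).
case: eqP => Rr /=; move=> eq eR; [left | right].
  split; first by move=> y /model_row xy /model_color; rewrite -xy Rr.
  split; first exact: model_goto.
  by move=> i _; apply: model_keep; rewrite // eR.
split; first exact: model_goto.
split; first by apply: model_dec; rewrite // eR /setreg eqxx prednK // lt0n; apply/eqP.
by move=> i _ ir; apply: model_keep; rewrite // eR /setreg (negbTE ir).
Qed.

Lemma model_init m x : t x + m = n -> init_in model m x.
Proof.
elim: m x => [|m IH] x e /=.
  by rewrite /trace ltnNge -e addn0 leqnn /= subnn.
have lt : t x < n by rewrite -e; lia.
split; first by rewrite /trace lt.
have [|y [ty _]] := @next x (k x) _ (Kk x); first by rewrite /active lt.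
exists y; split; first exact/model_succ.
exists y; split; first exact/model_row.
by apply: IH; rewrite ty addSnnS.
Qed.

Lemma model_holds x0 : t x0 = 0 -> holds model (fun=> x0) (And (Base b P) (Init n)).
Proof.
move=> tx0; split; first by apply/holds_Base; apply: model_base.
by apply/holds_Init; apply: model_init; rewrite tx0.
Qed.

End Completeness.

Lemma nonhalting_satisfiable P n :
  (forall k, ~~ halted P (iter k (step P) (init n))) ->
  satisfiable (And (Base true P) (Init n)).
Proof.
move=> nh; exists (nat * nat)%type, (model P n fst snd), (fun=> (0, 0)).
split; first exact: model_admissible.
apply: (@model_holds true P n _ fst snd predT) => //.
- by move=> [i j] j' _; exists (i, j').
- by move=> [i j] j' _ _; exists (i.+1, j').
Qed.

Lemma halting_fin_satisfiable P n k :
  halted P (iter k (step P) (init n)) -> fin_satisfiable (And (Base false P) (Init n)).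
Proof.
move=> hk; pose T := n + k.
exists ('I_T.+1 * 'I_T.+1)%type, (model P n (fun x => val x.1) (fun x => val x.2)),
  (fun=> (ord0, ord0)).
split; first exact: model_admissible.
apply: (@model_holds false P n _ _ _ (fun j => j < T.+1)) => //=.
- by move=> [i j] j' lt; exists (i, Ordinal lt).
- move=> [i j] j' act lt; have iT : i.+1 < T.+1.
    rewrite ltnS ltn_neqAle -ltnS ltn_ord andbT; apply/eqP => iT.
    by move: act; rewrite /active /= iT /T addKn hk ltnNge leq_addr.
  by exists (Ordinal iT, Ordinal lt).
- by move=> [i j] r j' lt; apply: leq_trans (leq_trans lt (trace_bound _ _ _ _)) (ltnW _).
Qed.

(** * The diagonal argument *)

Section Diagonal.
Variables (b0 : nat) (ks : seq nat).
Hypothesis code_Init_iter : forall n, code (Init n) = iter n (foldr cpair ^~ ks) b0.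

Section Prog.
Variable P : seq instr.

Definition tail_addr : nat := csize (diag_cmd b0 ks) + size P.
Definition prog (tail : seq instr) : seq instr :=
  compile 7 0 (diag_cmd b0 ks) ++ relocate (csize (diag_cmd b0 ks)) P ++ tail.

Lemma prog_run tail f out : computes P (code (And f (Init (code f)))) out ->
  exists2 R, run (prog tail) (init (code f)) (tail_addr, R) & R 0 = out.
Proof.
have -> : code (And f (Init (code f))) = cpair 3 (cpair (code f) (code (Init (code f)))).
  by [].
rewrite code_Init_iter; move: (code f) => n [k [hk <-]].
have X := exec_diag b0 ks n; set m := cpair 3 _ in hk X *.
exists (iter k (step P) (init m)).2 => //.
have init_store i : (init i).2 = store [:: i; 0; 0; 0; 0; 0; 0].
  by apply: functional_extensionality => r; do 7![case: r => [//|r]]; rewrite /store /= nth_nil.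
rewrite -!init_store in X.
have := @compile_correct 7 _ _ _ X erefl (avoids_diag _ _) [::]
  (relocate (csize (diag_cmd b0 ks)) P ++ tail).
rewrite add0n => /run_trans; apply.
have := @relocate_correct (compile 7 0 (diag_cmd b0 ks)) P tail k 0 (init m).2 hk.
by rewrite size_compile min0n addn0.
Qed.

Lemma step_tail i tail R :
  step (prog (i :: tail)) (tail_addr, R) =
  match i with
  | INC r => (tail_addr.+1, setreg R r (R r).+1)
  | DEC r j => if R r == 0 then (j, R) else (tail_addr.+1, setreg R r (R r).-1)
  end.
Proof.
rewrite /prog catA.
have -> : tail_addr = size (compile 7 0 (diag_cmd b0 ks) ++
                            relocate (csize (diag_cmd b0 ks)) P).
  by rewrite size_cat size_compile size_map.
by case: i => [r|r j]; rewrite ?step_INC ?step_DEC.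
Qed.

Lemma size_prog tail : size (prog tail) = tail_addr + size tail.
Proof. by rewrite !size_cat size_compile size_map addnA. Qed.

End Prog.

Lemma sat_undecidable : ~ decidable_form satisfiable.
Proof.
case=> P decP; pose a := tail_addr P; pose M := prog P [:: DEC 0 a].
pose n := code (Base true M); pose f := And (Base true M) (Init n).
have sizeM : size M = a.+1 by rewrite size_prog addn1.
have stM R : step M (a, R) = if R 0 == 0 then (a, R) else (a.+1, setreg R 0 (R 0).-1).
  exact: step_tail.
have Mn out : computes P (code f) out ->
    exists2 R, run M (init n) (a, R) & R 0 = out by apply: prog_run.
have [sat unsat] := decP f.
have nsat : ~ satisfiable f.
  move=> Sf; have [R runM R0] := Mn 1 (sat Sf).
  have [k Ek] := run_trans runM (run_step (run_refl M _)).
  have /negP := @Base_Init_nonhalting M n (leq_trans (ltn0Sn _) (eq_leq (esym sizeM))) Sf k.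
  by apply; rewrite Ek stM R0 /halted sizeM.
have [R runM R0] := Mn 0 (unsat nsat).
apply/nsat/nonhalting_satisfiable => k; apply: stuck_never_halts runM _ _.
  by rewrite stM R0.
by rewrite /halted sizeM ltnn.
Qed.

Lemma finsat_undecidable : ~ decidable_form fin_satisfiable.
Proof.
case=> P decP; pose a := tail_addr P; pose M := prog P [:: DEC 0 a.+2; DEC 0 a.+1].
pose n := code (Base false M); pose f := And (Base false M) (Init n).
have sizeM : size M = a.+2 by rewrite size_prog addn2.
have stM R : step M (a, R) = if R 0 == 0 then (a.+2, R) else (a.+1, setreg R 0 (R 0).-1).
  exact: step_tail.
have Mn out : computes P (code f) out ->
    exists2 R, run M (init n) (a, R) & R 0 = out by apply: prog_run.
have [sat unsat] := decP f.
have nsat : ~ fin_satisfiable f.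
  move=> Sf; have [R runM R0] := Mn 1 (sat Sf).
  apply: (@Base_Init_halting M n _ Sf); first by rewrite sizeM.
  move=> k; apply: (@stuck_never_halts _ _ (a.+1, setreg R 0 0)).
  - by apply: run_trans runM _; apply: run_step; rewrite stM R0; apply: run_refl.
  - rewrite /step sizeM ltnSn /M /prog catA.
    rewrite nth_cat size_cat size_compile size_map -/(tail_addr P) -/a.
    by rewrite ltnNge leqnSn subSnn.
  - by rewrite /halted sizeM ltnn.
have [R runM R0] := Mn 0 (unsat nsat).
have [k Ek] := run_trans runM (run_step (run_refl M _)).
apply/nsat/(@halting_fin_satisfiable M n k).
by rewrite Ek stM R0 /halted sizeM.
Qed.

End Diagonal.

Theorem theorem5 :
  ~ decidable_form satisfiable /\ ~ decidable_form fin_satisfiable.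
Proof.
have [b0 [ks Hc]] := code_Init.
by split; [apply: sat_undecidable Hc | apply: finsat_undecidable Hc].
Qed.
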